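(* Let $u:\mathbb{R}\times I\to J$, $u=u(x,t)$, be a $C^2$ function. The second order partial differential equation $$u_{tt}+a(x,t)u_{xt}=b(x,t)+(u_t+a(x,t)u_x)f(u)$$ can be transformed to $$\frac{d}{dt}\big(u_t(x(t),t)\big)=H'(t)+K'(u)\,(u_t+a u_x),$$ where the functions $H$ and $K$ are the general solutions of $$H'(t)=b(x(t),t),\qquad K'(u)=f(u).$$ That is, $u$ satisfies the partial differential equation on $\mathbb{R}\times I$ if and only if, along every characteristic $x(\cdot)$, the transformed equation holds for all $t\in I$, with $u,u_t,u_x$ evaluated at $(x(t),t)$ and $a$ at $(x(t),t)$.
   Context: $I\subseteq\mathbb{R}$ is an open interval containing $0$ and $J\subseteq\mathbb{R}$ is an open interval. The functions $a,b:\mathbb{R}\times I\to\mathbb{R}$ and $f:J\to\mathbb{R}$ are given and smooth. A characteristic is a solution $x(\cdot)$ of $\frac{dx(t)}{dt}=a(x(t),t)$, $x(0)=x_0$, with $x_0\in\mathbb{R}$. It is assumed that all characteristics are defined for all $t\in I$, so that through each point of $\mathbb{R}\times I$ there passes exactly one characteristic. The function $H$ is a function of $t\in I$ depending on the chosen characteristic, and $K$ is a function on $J$. *)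

(* Defs.v *)
From Stdlib Require Export Reals.
From Coquelicot Require Export Coquelicot.
Open Scope R_scope.

(** A real function on an open subset of R or R^2 is represented by a total
    function; every notion below only depends on its values on that subset,
    since [ex_diff_n], [Derive] and [is_derive] are local. *)

Definition open_interval (D : R -> Prop) : Prop :=
  exists lo hi : Rbar, Rbar_lt lo hi /\
    forall t : R, D t <-> Rbar_lt lo t /\ Rbar_lt t hi.

(** [g] is of class C^n on R x D: [ex_diff_n] asserts continuity together with
    existence of the first partial derivatives, recursively of class C^(n-1). *)
Definition Cn_strip (n : nat) (D : R -> Prop) (g : R -> R -> R) : Prop :=
  forall x t : R, D t -> ex_diff_n g n x t.

Definition smooth_strip (D : R -> Prop) (g : R -> R -> R) : Prop :=
  forall n : nat, Cn_strip n D g.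

Definition smooth_on (D : R -> Prop) (g : R -> R) : Prop :=
  forall (n : nat) (y : R), D y -> ex_derive_n g n y.

Definition d_x (g : R -> R -> R) (x t : R) : R := Derive (fun y => g y t) x.
Definition d_t (g : R -> R -> R) (x t : R) : R := Derive (fun s => g x s) t.

Definition characteristic (a : R -> R -> R) (D : R -> Prop)
    (x0 : R) (x : R -> R) : Prop :=
  x 0 = x0 /\ forall t : R, D t -> is_derive x t (a (x t) t).

(** Global solvability from time 0 does not by itself make the characteristics
    cover R x D (for a(x,t) = - t x^3 they satisfy |t x(t)| < 1),
    so the covering property is a separate clause. Uniqueness is as functions
    on D. *)
Definition complete_characteristics (a : R -> R -> R) (D : R -> Prop) : Prop :=
  (forall x0 : R, exists x : R -> R, characteristic a D x0 x) /\
  (forall x1 t1 : R, D t1 ->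
     exists (x0 : R) (x : R -> R),
       (characteristic a D x0 x /\ x t1 = x1) /\
       forall (y0 : R) (y : R -> R),
         characteristic a D y0 y -> y t1 = x1 ->
         forall t : R, D t -> y t = x t).

Definition solves_pde (a b : R -> R -> R) (f : R -> R) (D : R -> Prop)
    (u : R -> R -> R) : Prop :=
  forall x t : R, D t ->
    d_t (d_t u) x t + a x t * d_t (d_x u) x t
    = b x t + (d_t u x t + a x t * d_x u x t) * f (u x t).

Definition primitive_on (D : R -> Prop) (g G : R -> R) : Prop :=
  forall y : R, D y -> is_derive G y (g y).

Definition transformed_along (a : R -> R -> R) (D : R -> Prop)
    (u : R -> R -> R) (H K : R -> R) (x : R -> R) : Prop :=
  forall t : R, D t ->
    is_derive (fun s => d_t u (x s) s) t
      (Derive H t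
       + Derive K (u (x t) t) * (d_t u (x t) t + a (x t) t * d_x u (x t) t)).

(* Main.v *)
Require Import Defs.

(** The left-hand side of the equation is a directional derivative. If
    x' = a(x,t), the chain rule applied to the C^1 function u_t gives

      d/dt u_t(x(t),t) = u_tt + a u_tx = u_tt + a u_xt   at (x(t),t),

    the last step being the symmetry of the second derivatives of the C^2
    function u ([is_derive_d_t_along]). As H'(t) = b(x(t),t) and K'(u) = f(u),
    the transformed equation at time t is therefore the partial differential
    equation at the single point (x(t),t). One implication restricts the
    equation to a characteristic; the other holds because every point of the
    strip lies on some characteristic.

    The functions H and K exist as integrals of continuous functions over
    subintervals of I and J ([primitive_exists]): f is continuous on J, and
    t |-> b(x(t),t) is continuous on I. *)

Lemma open_interval_open (D : R -> Prop) :
  open_interval D -> open D.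
Proof.
  intros (lo & hi & _ & HD) t Ht. apply HD in Ht.
  apply (filter_imp (fun s : R => Rbar_lt lo s /\ Rbar_lt s hi)).
  - intros s; apply HD.
  - apply (open_and _ _ (open_Rbar_gt lo) (open_Rbar_lt hi) t Ht).
Qed.

Lemma open_interval_convex (D : R -> Prop) (p q r : R) :
  open_interval D -> D p -> D q -> Rmin p q <= r <= Rmax p q -> D r.
Proof.
  intros (lo & hi & _ & HD) Hp Hq Hr. apply HD in Hp, Hq. apply HD.
  destruct Hp as [Hp1 Hp2], Hq as [Hq1 Hq2].
  split.
  - apply Rbar_lt_le_trans with (Rmin p q); [|exact (proj1 Hr)].
    unfold Rmin; destruct (Rle_dec p q); assumption.
  - apply Rbar_le_lt_trans with (Rmax p q); [exact (proj2 Hr)|].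
    unfold Rmax; destruct (Rle_dec p q); assumption.
Qed.

Lemma primitive_exists (D : R -> Prop) (g : R -> R) (c : R) :
  open_interval D -> D c -> (forall y, D y -> continuous g y) ->
  exists G : R -> R, primitive_on D g G.
Proof.
  intros HD Hc Hg.
  exists (RInt g c). intros y Hy.
  apply (is_derive_RInt g (RInt g c) c y); [|exact (Hg y Hy)].
  apply (filter_imp D); [|exact (open_interval_open D HD y Hy)].
  intros z Hz.
  apply (RInt_correct (V := R_CompleteNormedModule)).
  apply (ex_RInt_continuous (V := R_CompleteNormedModule)).
  intros w Hw. exact (Hg w (open_interval_convex D c z w HD Hc Hz Hw)).
Qed.

Lemma locally_2d_strip (D : R -> Prop) (P : R -> R -> Prop) (x t : R) :
  open D -> D t -> (forall u v, D v -> P u v) -> locally_2d P x t.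
Proof.
  intros HD Ht HP. destruct (HD t Ht) as [e He].
  exists e. intros u v _ Hv. exact (HP u v (He v Hv)).
Qed.

(** For b along a characteristic, this continuity is what makes H exist. *)
Lemma continuous_along (g : R -> R -> R) (x : R -> R) (t : R) :
  continuity_2d_pt g (x t) t -> continuous x t ->
  continuous (fun s => g (x s) s) t.
Proof.
  intros Hg Hx.
  apply (continuous_comp_2 x (fun s => s) g t Hx (continuous_id t)).
  apply continuity_2d_pt_filterlim. exact Hg.
Qed.

(** The chain rule along the curve s |-> (x(s), s). Differentiability of g at
    the point follows from continuity of one partial derivative together with
    mere existence of the other. *)
Lemma is_derive_along (g : R -> R -> R) (x : R -> R) (t l : R) :
  locally_2d (fun y s => ex_derive (fun z => g z s) y) (x t) t ->
  ex_derive (fun s => g (x t) s) t ->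
  continuity_2d_pt (d_x g) (x t) t ->
  is_derive x t l ->
  is_derive (fun s => g (x s) s) t (d_t g (x t) t + l * d_x g (x t) t).
Proof.
  intros Hx Ht Hc Hd.
  assert (Hf : filterdiff (fun p : R * R => g (fst p) (snd p))
     (locally (x t, t))
     (fun p : R * R => plus (scal (fst p) (d_x g (x t) t))
                            (scal (snd p) (d_t g (x t) t)))).
  { apply is_derive_filterdiff.
    - apply locally_2d_locally in Hx. revert Hx. apply filter_imp.
      intros p Hp. apply Derive_correct, Hp.
    - apply Derive_correct, Ht.
    - apply continuity_2d_pt_filterlim in Hc. exact Hc. }
  unfold is_derive.
  eapply filterdiff_ext_lin.
  - exact (filterdiff_comp'_2 x (fun s : R => s) g t
       (fun h => scal h l) (fun h => h)
       (fun p q => plus (scal p (d_x g (x t) t)) (scal q (d_t g (x t) t)))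
       Hd (filterdiff_id _) Hf).
  - intros h. unfold plus, scal; simpl; unfold mult; simpl. ring.
Qed.

Lemma mixed_partials (D : R -> Prop) (u : R -> R -> R) (x t : R) :
  open D -> Cn_strip 2 D u -> D t -> d_x (d_t u) x t = d_t (d_x u) x t.
Proof.
  intros HD Hu Ht.
  destruct (Hu x t Ht) as
    (_ & _ & _ & (_ & _ & _ & _ & Hxt & _) & (_ & _ & _ & (Htx & _) & _)).
  apply Schwarz; [|exact Htx|exact Hxt].
  apply locally_2d_strip with D; trivial.
  intros y s Hs.
  destruct (Hu y s Hs) as
    (_ & H1 & H2 & (_ & _ & H3 & _) & (_ & H4 & _)).
  repeat split; assumption.
Qed.

(** The heart of the proof: with l = a(x(t),t) the derivative is the left-hand
    side of the partial differential equation. The chain rule yields the mixed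
    derivative as d_x (d_t u), whereas the equation contains d_t (d_x u). *)
Lemma is_derive_d_t_along (D : R -> Prop) (u : R -> R -> R) (x : R -> R) (t l : R) :
  open D -> Cn_strip 2 D u -> D t -> is_derive x t l ->
  is_derive (fun s => d_t u (x s) s) t
    (d_t (d_t u) (x t) t + l * d_t (d_x u) (x t) t).
Proof.
  intros HD Hu Ht Hx.
  rewrite <- (mixed_partials D u (x t) t HD Hu Ht).
  apply is_derive_along; trivial.
  - apply locally_2d_strip with D; trivial.
    intros y s Hs. destruct (Hu y s Hs) as (_ & _ & _ & _ & (_ & H & _)). exact H.
  - destruct (Hu (x t) t Ht) as (_ & _ & _ & _ & (_ & _ & H & _)). exact H.
  - destruct (Hu (x t) t Ht) as (_ & _ & _ & _ & (_ & _ & _ & (H & _) & _)). exact H.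
Qed.

Theorem proposition3
    (I J : R -> Prop) (a b : R -> R -> R) (f : R -> R) (u : R -> R -> R)
    (hI : open_interval I) (hI0 : I 0) (hJ : open_interval J)
    (ha : smooth_strip I a) (hb : smooth_strip I b) (hf : smooth_on J f)
    (hchar : complete_characteristics a I)
    (huJ : forall x t : R, I t -> J (u x t))
    (hu : Cn_strip 2 I u) :
  (exists K : R -> R, primitive_on J f K) /\
  (forall (x0 : R) (x : R -> R), characteristic a I x0 x ->
     exists H : R -> R, primitive_on I (fun t => b (x t) t) H) /\
  (forall (K : R -> R) (H : (R -> R) -> R -> R),
     primitive_on J f K ->
     (forall (x0 : R) (x : R -> R), characteristic a I x0 x ->
        primitive_on I (fun t => b (x t) t) (H x)) ->
     (solves_pde a b f I u <->
      forall (x0 : R) (x : R -> R), characteristic a I x0 x ->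
        transformed_along a I u (H x) K x)).
Proof.
  assert (hIo := open_interval_open I hI).
  split; [|split; [|intros K H HK HH; split]].
  - apply (primitive_exists J f (u 0 0) hJ (huJ 0 0 hI0)).
    intros y Hy. apply (ex_derive_continuous (V := R_NormedModule)).
    exact (hf 1%nat y Hy).
  - intros x0 x [_ Hx]. apply (primitive_exists I _ 0 hI hI0).
    intros t Ht. apply continuous_along.
    + exact (proj1 (hb 0%nat (x t) t Ht)).
    + apply (ex_derive_continuous (V := R_NormedModule)).
      eexists. exact (Hx t Ht).
  - intros Hpde x0 x Hx t Ht.
    rewrite (is_derive_unique _ _ _ (HH x0 x Hx t Ht)).
    rewrite (is_derive_unique _ _ _ (HK (u (x t) t) (huJ _ t Ht))).
    replace (_ + _) with
      (d_t (d_t u) (x t) t + a (x t) t * d_t (d_x u) (x t) t)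
      by (rewrite (Hpde (x t) t Ht); ring).
    exact (is_derive_d_t_along I u x t _ hIo hu Ht (proj2 Hx t Ht)).
  - intros Htr x1 t Ht.
    destruct (proj2 hchar x1 t Ht) as (x0 & x & [Hx <-] & _).
    assert (Hd := Htr x0 x Hx t Ht).
    rewrite (is_derive_unique _ _ _ (HH x0 x Hx t Ht)) in Hd.
    rewrite (is_derive_unique _ _ _ (HK (u (x t) t) (huJ _ t Ht))) in Hd.
    apply is_derive_unique in Hd.
    rewrite (is_derive_unique _ _ _
      (is_derive_d_t_along I u x t _ hIo hu Ht (proj2 Hx t Ht))) in Hd.
    rewrite Hd; ring.
Qed.
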